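(* Let $\mathbb F$ be a field with $\operatorname{char}\mathbb F=0$, and let $R=R(A,\alpha,v,\rho)$ be an ambiskew polynomial ring over an $\mathbb F$-algebra $A$ (with associated automorphism $\gamma$). Then $R$ is simple if and only if the following three conditions hold: (i) $A$ is $\alpha$-simple; (ii) the $4$-tuple $(A,\alpha,v,\rho)$ is singular; (iii) for all $m\geq 1$, $v^{(m)}:=\sum_{l=0}^{m-1}\rho^{l}\alpha^{l}(v)$ is a unit of $A$.
   Context: Rings are associative with $1$. For an automorphism $\gamma$ of a ring $A$, an element $v\in A$ is $\gamma$-normal if $va=\gamma(a)v$ for all $a\in A$ and $\gamma(v)=v$. An ideal $I$ of $A$ is an $\alpha$-ideal if $\alpha(I)\subseteq I$; $A$ is $\alpha$-simple if $0$ and $A$ are its only $\alpha$-ideals. Ambiskew polynomial ring: Let $\mathbb F$ be a field, $A$ an $\mathbb F$-algebra, $\rho\in\mathbb F\setminus\{0\}$, $\gamma$ an $\mathbb F$-automorphism of $A$, $v$ a $\gamma$-normal element of $A$, $\alpha$ an $\mathbb F$-automorphism of $A$ with $\alpha\gamma=\gamma\alpha$, and $\beta:=\alpha^{-1}\gamma$. Extend $\beta$ to an automorphism of $A[y;\alpha]$ with $\beta(y)=\rho y$; there is a $\beta$-derivation $\delta$ of $A[y;\alpha]$ with $\delta(A)=0$, $\delta(y)=v$. The ambiskew polynomial ring is $R(A,\alpha,v,\rho)=A[y;\alpha][x;\beta,\delta]$; thus it is generated over $A$ by $x,y$ with $ya=\alpha(a)y$, $xa=\beta(a)x$ ($a\in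 A$) and $xy=\rho yx+v$. The automorphism $\gamma$ is part of the data. $(A,\alpha,v,\rho)$ is conformal if there is a $\gamma$-normal element $u\in A$ with $v=u-\rho\alpha(u)$; otherwise it is singular. *)

(* Defs.v *)
From HB Require Import structures.
From mathcomp Require Import all_boot all_algebra.

Set Implicit Arguments.
Unset Strict Implicit.
Unset Printing Implicit Defensive.

Import GRing.Theory.
Local Open Scope ring_scope.

(* Ideals are Prop-valued: boolean predicates would only capture the decidable
   ones. *)
Record is_ideal (R : nzRingType) (I : R -> Prop) : Prop := IsIdeal {
  ideal0 : I 0;
  idealB : forall a b, I a -> I b -> I (a - b);
  idealMl : forall r a, I a -> I (r * a);
  idealMr : forall r a, I a -> I (a * r)
}.

(* [R : nzRingType] is nonzero. *)
Definition simple_ring (R : nzRingType) : Prop :=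
  forall I : R -> Prop, is_ideal I ->
    (forall a, I a <-> a = 0) \/ (forall a, I a).

(* MathComp's [GRing.unit] needs decidable invertibility, which a general
   algebra does not carry. *)
Definition is_unit (R : nzRingType) (a : R) : Prop :=
  exists b : R, b * a = 1 /\ a * b = 1.

(* Ore extensions B[x; s, d], with x b = s(b) x + d(b). *)

Definition skew_derivation (B : nzRingType) (s d : B -> B) : Prop :=
  forall a b, d (a * b) = s a * d b + d a * b.

Record ore_datum (B : nzRingType) := OreDatum {
  ore_auto : {rmorphism B -> B};
  ore_der : {additive B -> B};
  ore_derP : skew_derivation ore_auto ore_der
}.

(* The polynomial \sum_i b_i 'X^i stands for the left normal form
   \sum_i b_i x^i. *)
Definition ore (B : nzRingType) (D : ore_datum B) : Type := {poly B}.

Section Ore.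
Variables (B : nzRingType) (D : ore_datum B).
Local Notation s := (ore_auto D).
Local Notation d := (ore_der D).

(* Left multiplication by x. *)
Definition ore_shift (p : {poly B}) : {poly B} :=
  map_poly s p * 'X + map_poly d p.

Definition ore_mul (p q : {poly B}) : {poly B} :=
  \sum_(i < size p) p`_i *: iter i ore_shift q.

Lemma ore_shiftD p q : ore_shift (p + q) = ore_shift p + ore_shift q.
Proof. by rewrite /ore_shift !raddfD /= mulrDl addrACA. Qed.

Lemma ore_shift0 : ore_shift 0 = 0.
Proof. by rewrite /ore_shift !raddf0 mul0r addr0. Qed.

Lemma iter_ore_shiftD n p q :
  iter n ore_shift (p + q) = iter n ore_shift p + iter n ore_shift q.
Proof. by elim: n => //= n ->; rewrite ore_shiftD. Qed.

Lemma iter_ore_shift0 n : iter n ore_shift 0 = 0.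
Proof. by elim: n => //= n ->; rewrite ore_shift0. Qed.

Lemma ore_shiftZ b p :
  ore_shift (b *: p) = s b *: ore_shift p + d b *: p.
Proof.
apply/polyP=> i; rewrite /ore_shift !(coefD, coefZ, coefMX, coef_map) /=.
rewrite ore_derP mulrDr addrA.
by case: (i == 0)%N; rewrite ?mulr0 // rmorphM.
Qed.

Lemma ore_der1 : d 1 = 0.
Proof.
apply: (addrI (d 1)); rewrite addr0 -[in RHS](mulr1 1) ore_derP.
by rewrite rmorph1 mul1r mulr1.
Qed.

Lemma ore_shiftXn n : ore_shift 'X^n = 'X^(n.+1).
Proof.
rewrite /ore_shift map_polyXn -exprSr.
suff -> : map_poly d 'X^n = 0 by rewrite addr0.
apply/polyP=> i; rewrite coef_map coefXn coef0.
by case: eqP => _; rewrite ?ore_der1 ?raddf0.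
Qed.

Lemma iter_ore_shift1 n : iter n ore_shift 1 = 'X^n.
Proof. by elim: n => //= n ->; rewrite ore_shiftXn. Qed.

Lemma ore_mulE n (p q : {poly B}) : (size p <= n)%N ->
  ore_mul p q = \sum_(i < n) p`_i *: iter i ore_shift q.
Proof.
move=> le_pn; rewrite /ore_mul -(subnKC le_pn) big_split_ord /=.
rewrite [X in _ = _ + X]big1 ?addr0 // => i _.
by rewrite nth_default ?scale0r // leq_addr.
Qed.

Lemma ore_mulDl p q r : ore_mul (p + q) r = ore_mul p r + ore_mul q r.
Proof.
pose n := maxn (size p) (size q).
rewrite !(@ore_mulE n) ?leq_maxl ?leq_maxr ?size_polyD // -big_split /=.
by apply: eq_bigr => i _; rewrite coefD scalerDl.
Qed.

Lemma ore_mulDr p q r : ore_mul p (q + r) = ore_mul p q + ore_mul p r.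
Proof.
rewrite /ore_mul -big_split /=.
by apply: eq_bigr => i _; rewrite iter_ore_shiftD scalerDr.
Qed.

Lemma ore_mul0l q : ore_mul 0 q = 0.
Proof. by rewrite /ore_mul size_poly0 big_ord0. Qed.

Lemma ore_mul0r p : ore_mul p 0 = 0.
Proof. by rewrite /ore_mul big1 // => i _; rewrite iter_ore_shift0 scaler0. Qed.

Lemma ore_mulZl b p q : ore_mul (b *: p) q = b *: ore_mul p q.
Proof.
rewrite (@ore_mulE (size p)) ?size_scale_leq // scaler_sumr.
by apply: eq_bigr => i _; rewrite coefZ scalerA.
Qed.

Lemma ore_mulXn n q : ore_mul 'X^n q = iter n ore_shift q.
Proof.
rewrite /ore_mul size_polyXn big_ord_recr /= coefXn eqxx scale1r.
by rewrite big1 ?add0r // => i _; rewrite coefXn ltn_eqF ?scale0r.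
Qed.

Lemma ore_mul1p q : ore_mul 1 q = q.
Proof. exact: (ore_mulXn 0). Qed.

Lemma ore_mulC b q : ore_mul b%:P q = b *: q.
Proof. by rewrite -alg_polyC ore_mulZl ore_mul1p. Qed.

Lemma ore_ind (P : {poly B} -> Prop) :
    P 0 -> (forall p q, P p -> P q -> P (p + q)) ->
    (forall b n, P (b *: 'X^n)) -> forall p, P p.
Proof.
move=> P0 PD PM p; rewrite -[p]coefK poly_def.
by apply: big_ind => // i _; apply: PM.
Qed.

Lemma ore_mul_shift p q : ore_mul (ore_shift p) q = ore_shift (ore_mul p q).
Proof.
elim/ore_ind: p => [|p r IHp IHr|b n].
- by rewrite ore_shift0 ore_mul0l ore_shift0.
- by rewrite ore_shiftD (ore_mulDl (ore_shift p)) (ore_mulDl p) IHp IHr ore_shiftD.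
have -> : ore_shift (b *: 'X^n) = s b *: 'X^(n.+1) + d b *: 'X^n.
  by rewrite ore_shiftZ ore_shiftXn.
by rewrite ore_mulDl !ore_mulZl !ore_mulXn ore_shiftZ.
Qed.

Fact ore_mulA : associative ore_mul.
Proof.
move=> p q r; elim/ore_ind: p => [|p p' IHp IHp'|b n].
- by rewrite !ore_mul0l.
- by rewrite !ore_mulDl IHp IHp'.
rewrite !ore_mulZl !ore_mulXn; congr (_ *: _).
by elim: n => //= n ->; rewrite ore_mul_shift.
Qed.

Fact ore_mul1r : right_id 1 ore_mul.
Proof.
move=> p; rewrite /ore_mul -[RHS]coefK poly_def.
by apply: eq_bigr => i _; rewrite iter_ore_shift1.
Qed.

HB.instance Definition _ := GRing.Zmodule.on (ore D).
HB.instance Definition _ := GRing.Zmodule_isNzRing.Build (ore D)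
  ore_mulA ore_mul1p ore_mul1r ore_mulDl ore_mulDr (oner_neq0 {poly B}).

Definition ore_const (b : B) : ore D := b%:P.
Definition ore_var : ore D := 'X.

Lemma ore_constM a b : ore_const (a * b) = ore_const a * ore_const b.
Proof. by rewrite [RHS]ore_mulC -mul_polyC -polyCM. Qed.

Lemma ore_varM b : ore_var * ore_const b = ore_const (s b) * ore_var
                                           + ore_const (d b).
Proof.
rewrite [LHS](ore_mulXn 1) [X in _ = X + _]ore_mulC /= /ore_shift.
by rewrite !map_polyC mul_polyC.
Qed.

End Ore.

Record alg_aut (F : fieldType) (A : algType F) := AlgAut {
  aut_fun :> {lrmorphism A -> A};
  aut_inv : A -> A;
  autK : cancel aut_fun aut_inv;
  aut_invK : cancel aut_inv aut_fun
}.

Section AutInverse.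
Variables (F : fieldType) (A : algType F) (f : alg_aut A).

Fact aut_inv_zmod : zmod_morphism (aut_inv f).
Proof. exact: can2_zmod_morphism (autK f) (aut_invK f). Qed.
Fact aut_inv_monoid : monoid_morphism (aut_inv f).
Proof. exact: can2_monoid_morphism (autK f) (aut_invK f). Qed.
Fact aut_inv_scalable : scalable (aut_inv f).
Proof. exact: can2_scalable (autK f) (aut_invK f). Qed.

HB.instance Definition _ := GRing.isZmodMorphism.Build A A (aut_inv f) aut_inv_zmod.
HB.instance Definition _ := GRing.isMonoidMorphism.Build A A (aut_inv f) aut_inv_monoid.
HB.instance Definition _ := GRing.isScalable.Build F A A *:%R (aut_inv f) aut_inv_scalable.
End AutInverse.

Definition gamma_normal (A : nzRingType) (g : A -> A) (v : A) : Prop :=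
  (forall a, v * a = g a * v) /\ g v = v.

Record ambiskew_datum (F : fieldType) (A : algType F) := AmbiskewDatum {
  am_alpha : alg_aut A;
  am_gamma : alg_aut A;
  am_v : A;
  am_rho : F;
  am_comm : forall a, am_alpha (am_gamma a) = am_gamma (am_alpha a);
  am_normal : gamma_normal am_gamma am_v;
  am_rho_neq0 : am_rho != 0
}.

Section Ambiskew.
Variables (F : fieldType) (A : algType F) (D : ambiskew_datum A).
Local Notation alpha := (am_alpha D).
Local Notation gamma := (am_gamma D).
Local Notation v := (am_v D).
Local Notation rho := (am_rho D).

Definition conformal : Prop :=
  exists2 u : A, gamma_normal gamma u & v = u - rho *: alpha u.

Definition singular : Prop := ~ conformal.

Definition vpow (m : nat) : A := \sum_(l < m) rho ^+ l *: iter l alpha v.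

Lemma iter_alphaZ k c a : iter k alpha (c *: a) = c *: iter k alpha a.
Proof. by elim: k => //= k ->; rewrite linearZ. Qed.

Lemma iter_alphaM k a b :
  iter k alpha (a * b) = iter k alpha a * iter k alpha b.
Proof. by elim: k => //= k ->; rewrite rmorphM. Qed.

Lemma vpow0 : vpow 0 = 0.
Proof. exact: big_ord0. Qed.

Lemma vpow1 : vpow 1 = v.
Proof. by rewrite /vpow big_ord1 scale1r. Qed.

Lemma vpowD m n : vpow (m + n) = vpow m + rho ^+ m *: iter m alpha (vpow n).
Proof.
rewrite /vpow big_split_ord /=; congr (_ + _).
have iter_alpha_sum k (f : 'I_n -> A) :
    iter k alpha (\sum_l f l) = \sum_l iter k alpha (f l).
  by elim: k => //= k ->; rewrite raddf_sum.
rewrite iter_alpha_sum scaler_sumr; apply: eq_bigr => l _.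
by rewrite iter_alphaZ scalerA -exprD iterD.
Qed.

Definition beta (a : A) : A := aut_inv alpha (gamma a).

Fact beta_zmod : zmod_morphism beta.
Proof. by move=> a b; rewrite /beta !raddfB. Qed.
Fact beta_monoid : monoid_morphism beta.
Proof. by split=> [|a b]; rewrite /beta ?rmorph1 // !rmorphM. Qed.
Fact beta_scalable : scalable beta.
Proof. by move=> c a; rewrite /beta !linearZ. Qed.
HB.instance Definition _ := GRing.isZmodMorphism.Build A A beta beta_zmod.
HB.instance Definition _ := GRing.isMonoidMorphism.Build A A beta beta_monoid.
HB.instance Definition _ :=
  GRing.isScalable.Build F A A *:%R beta beta_scalable.

Lemma alpha_beta a : alpha (beta a) = gamma a.
Proof. exact: aut_invK. Qed.

Lemma beta_alpha a : beta (alpha a) = gamma a.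
Proof. by rewrite /beta -am_comm autK. Qed.

Lemma iter_alpha_beta n a : beta (iter n alpha a) = iter n alpha (beta a).
Proof. by elim: n => //= n <-; rewrite alpha_beta beta_alpha. Qed.

Lemma vpow_normal m a : vpow m * a = gamma a * vpow m.
Proof.
rewrite /vpow mulr_suml mulr_sumr; apply: eq_bigr => l _.
rewrite -scalerAl -scalerAr; congr (_ *: _).
elim: (l : nat) a => [|n IHn] a /=; first exact: (am_normal D).1.
by rewrite -[a](aut_invK alpha) -am_comm -!rmorphM IHn.
Qed.

Fact zero_skew_derivation : skew_derivation alpha (\0 : A -> A).
Proof. by move=> a b /=; rewrite mulr0 mul0r addr0. Qed.

Definition skew_poly_datum : ore_datum A :=
  @OreDatum A alpha (\0 : A -> A) zero_skew_derivation.
Definition skew_poly : nzRingType := ore skew_poly_datum.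

Lemma skew_polyMmono a b i j :
  (a *: 'X^i : skew_poly) * (b *: 'X^j : skew_poly)
    = (a * iter i alpha b) *: 'X^(i + j) :> {poly A}.
Proof.
rewrite [LHS]ore_mulZl ore_mulXn -scalerA; congr (_ *: _).
elim: i => //= i ->; rewrite ore_shiftZ ore_shiftXn /= scale0r addr0 //.
Qed.

(* The extension of beta to A[y; alpha] with y |-> rho y, so that
   a y^i |-> beta(a) (rho y)^i. *)
Definition beta_ext (p : skew_poly) : skew_poly :=
  \poly_(i < size (p : {poly A})) (rho ^+ i *: beta (p : {poly A})`_i).

(* The derivation with A |-> 0 and y |-> v: the skew Leibniz rule forces
   a y^i |-> beta(a) v^(i) y^(i-1). *)
Definition delta (p : skew_poly) : skew_poly :=
  \poly_(i < (size (p : {poly A})).-1)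
    (beta (p : {poly A})`_i.+1 * vpow i.+1).

Lemma coef_beta_ext (p : skew_poly) i :
  (beta_ext p : {poly A})`_i = rho ^+ i *: beta (p : {poly A})`_i.
Proof.
rewrite coef_poly; case: ltnP => // le_pi.
by rewrite [(p : {poly A})`_i]nth_default // raddf0 scaler0.
Qed.

Lemma coef_delta (p : skew_poly) i :
  (delta p : {poly A})`_i = beta (p : {poly A})`_i.+1 * vpow i.+1.
Proof.
rewrite coef_poly; case: ltnP => // le_pi.
rewrite [(p : {poly A})`_i.+1]nth_default ?raddf0 ?mul0r //.
by case: (size _) le_pi.
Qed.

Fact beta_ext_zmod : zmod_morphism beta_ext.
Proof.
move=> p q; apply/polyP=> i.
by rewrite coefB !coef_beta_ext coefB raddfB scalerBr.
Qed.
HB.instance Definition _ :=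
  GRing.isZmodMorphism.Build skew_poly skew_poly beta_ext beta_ext_zmod.

Fact delta_zmod : zmod_morphism delta.
Proof.
move=> p q; apply/polyP=> i.
by rewrite coefB !coef_delta coefB raddfB mulrBl.
Qed.
HB.instance Definition _ :=
  GRing.isZmodMorphism.Build skew_poly skew_poly delta delta_zmod.

Lemma beta_ext_mono a i :
  beta_ext (a *: 'X^i) = (rho ^+ i *: beta a) *: 'X^i :> {poly A}.
Proof.
apply/polyP=> j; rewrite coef_beta_ext !coefZ !coefXn.
by case: eqP => [->|_]; rewrite ?mulr1 // !mulr0 raddf0 scaler0.
Qed.

Lemma delta_mono a i :
  delta (a *: 'X^i) = (beta a * vpow i) *: 'X^(i.-1) :> {poly A}.
Proof.
apply/polyP=> j; rewrite coef_delta !coefZ !coefXn.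
case: i => [|i]; first by rewrite vpow0 !mulr0 raddf0 !mul0r.
by rewrite eqSS; case: eqP => [->|_]; rewrite ?mulr1 // !mulr0 raddf0 mul0r.
Qed.

Fact beta_ext_monoid : monoid_morphism beta_ext.
Proof.
split=> [|p q].
  by have := beta_ext_mono 1 0; rewrite expr0 rmorph1 !scale1r.
elim/ore_ind: p => [|p p' IHp IHp'|a i].
- by rewrite !(mul0r, raddf0).
- by rewrite mulrDl !raddfD /= IHp IHp' mulrDl.
elim/ore_ind: q => [|q q' IHq IHq'|b j].
- by rewrite !(mulr0, raddf0).
- by rewrite mulrDr !raddfD /= IHq IHq' mulrDr.
rewrite skew_polyMmono !beta_ext_mono skew_polyMmono; congr (_ *: _).
by rewrite rmorphM /= iter_alpha_beta iter_alphaZ -scalerAl -scalerAr scalerA exprD.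
Qed.
HB.instance Definition _ :=
  GRing.isMonoidMorphism.Build skew_poly skew_poly beta_ext beta_ext_monoid.

Fact delta_skew : skew_derivation beta_ext delta.
Proof.
move=> p q; elim/ore_ind: p => [|p p' IHp IHp'|a i].
- by rewrite !(mul0r, raddf0) addr0.
- by rewrite mulrDl !raddfD /= IHp IHp' !mulrDl addrACA.
elim/ore_ind: q => [|q q' IHq IHq'|b j].
- by rewrite !(mulr0, raddf0) addr0.
- by rewrite mulrDr !raddfD /= IHq IHq' !mulrDr addrACA.
rewrite skew_polyMmono beta_ext_mono !delta_mono !skew_polyMmono.
have -> : ((rho ^+ i *: beta a) * iter i alpha (beta b * vpow j))
             *: 'X^(i + j.-1)
        = (beta a * beta (iter i alpha b) * (rho ^+ i *: iter i alpha (vpow j)))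
             *: 'X^((i + j).-1) :> {poly A}.
  case: j => [|j]; last first.
    rewrite addnS /= iter_alphaM iter_alpha_beta; congr (_ *: _).
    by rewrite -scalerAl -scalerAr mulrA.
  suff: iter i alpha (vpow 0) = 0.
    by move=> v0; rewrite iter_alphaM v0 scaler0 !mulr0 !scale0r.
  by rewrite vpow0; elim: (i) => //= k ->; rewrite raddf0.
have -> : (beta a * vpow i * iter i.-1 alpha b) *: 'X^(i.-1 + j)
        = (beta a * beta (iter i alpha b) * vpow i) *: 'X^((i + j).-1)
          :> {poly A}.
  case: i => [|i]; first by rewrite vpow0 !(mulr0, mul0r) !scale0r.
  by rewrite /= -!mulrA vpow_normal beta_alpha.
by rewrite -scalerDl -mulrDr addrC -vpowD rmorphM /=.
Qed.

Lemma beta_ext_const a :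
  beta_ext (ore_const skew_poly_datum a) = ore_const skew_poly_datum (beta a).
Proof. by have := beta_ext_mono a 0; rewrite !expr0 scale1r !alg_polyC. Qed.

Lemma beta_ext_y :
  beta_ext (ore_var skew_poly_datum)
    = ore_const skew_poly_datum rho%:A * ore_var skew_poly_datum.
Proof.
rewrite [RHS]ore_mulC; have := beta_ext_mono 1 1.
by rewrite !expr1 rmorph1 scale1r.
Qed.

Lemma delta_const a : delta (ore_const skew_poly_datum a) = 0.
Proof.
have := delta_mono a 0.
by rewrite !expr0 vpow0 mulr0 scale0r alg_polyC.
Qed.

Lemma delta_y : delta (ore_var skew_poly_datum) = ore_const skew_poly_datum v.
Proof.
have := delta_mono 1 1.
by rewrite expr1 vpow1 rmorph1 mul1r scale1r expr0 alg_polyC.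
Qed.

Fact beta_ext_bij : bijective beta_ext.
Proof.
have rho0 := am_rho_neq0 D.
exists (fun p : skew_poly =>
  \poly_(i < size (p : {poly A}))
    (rho ^- i *: aut_inv gamma (alpha (p : {poly A})`_i)) : skew_poly).
  move=> p; apply/polyP=> i; rewrite coef_poly coef_beta_ext.
  case: ltnP => [_|/leq_sizeP/(_ i (leqnn i))].
    by rewrite linearZ /= linearZ /= scalerA mulVf ?expf_neq0 // scale1r alpha_beta autK.
  rewrite coef_beta_ext => /eqP.
  rewrite scaler_eq0 expf_eq0 (negPf rho0) andbF /= => /eqP bp0.
  by apply: (can_inj (autK gamma)); rewrite -!alpha_beta bp0 /beta !raddf0.
move=> p; apply/polyP=> i; rewrite coef_beta_ext coef_poly.
case: ltnP => [_|le_pi]; last by rewrite raddf0 scaler0 nth_default.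
by rewrite linearZ /= scalerA mulfV ?expf_neq0 // scale1r /beta aut_invK autK.
Qed.

Definition ambiskew_ore_datum : ore_datum skew_poly :=
  @OreDatum skew_poly beta_ext delta delta_skew.

(* R(A, alpha, v, rho) = A[y; alpha][x; beta, delta] *)
Definition ambiskew : nzRingType := ore ambiskew_ore_datum.

Definition am_const (a : A) : ambiskew :=
  ore_const ambiskew_ore_datum (ore_const skew_poly_datum a).
Definition am_y : ambiskew :=
  ore_const ambiskew_ore_datum (ore_var skew_poly_datum).
Definition am_x : ambiskew := ore_var ambiskew_ore_datum.

Lemma am_yM a : am_y * am_const a = am_const (alpha a) * am_y.
Proof.
by rewrite -!ore_constM ore_varM /= [ore_const _ 0]polyC0 addr0.
Qed.

Lemma am_xM a : am_x * am_const a = am_const (beta a) * am_x.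
Proof.
by rewrite ore_varM /= beta_ext_const delta_const [ore_const _ 0]polyC0 addr0.
Qed.

Lemma am_xy : am_x * am_y = am_const rho%:A * am_y * am_x + am_const v.
Proof. by rewrite ore_varM /= beta_ext_y delta_y ore_constM. Qed.

End Ambiskew.

Definition alpha_ideal (F : fieldType) (A : algType F) (f : alg_aut A)
    (I : A -> Prop) : Prop :=
  is_ideal I /\ (forall a, I a -> I (f a)).

Definition alpha_simple (F : fieldType) (A : algType F) (f : alg_aut A) : Prop :=
  forall I : A -> Prop, alpha_ideal f I ->
    (forall a, I a <-> a = 0) \/ (forall a, I a).

(* Main.v *)
Require Import Defs.
From HB Require Import structures.
From mathcomp Require Import all_boot all_algebra.
From Stdlib Require Import Classical.

Set Implicit Arguments.
Unset Strict Implicit.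
Unset Printing Implicit Defensive.

Import GRing.Theory.
Local Open Scope ring_scope.

(* Necessity.  R acts on S = A[y; alpha] = R/Rx, with x acting as delta.  If R is
   simple, S/N is faithful for every proper submodule N.  Taking N = JS, with J the
   alpha-saturation of an alpha-ideal, gives (i); taking for N the sum of S y^m and
   of the alpha^(i-m+1)(v^(m) A) y^i with i < m gives (iii), since y^m kills S/N.
   If v = u - rho alpha(u), then xy - u is normal and generates a proper ideal,
   whence (ii).

   Sufficiency.  As v is a unit, t = v^-1 xy commutes with A and y t = tau(t) y,
   with tau(t) = k (t - 1) for a central unit k, so that after multiplication by a
   power of y every element of R is a form \sum_i f_i(t) y^i with f_i in A[t].
   A[t] is tau-simple: a monic polynomial of least degree n > 0 in a tau-ideal is
   central and semi-invariant, and its coefficient of t^(n-1), divided by -n, makes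
   v conformal.  In a nonzero ideal I of R, consider forms \sum_i f_i y^i of least
   y-degree d, up to powers of y on the right; one of them is monic, so that
   tau(f_0) = f_0 and tau^d(b) f_0 = f_0 b for all b.  Hence f_0 is a unit, and
   b = t gives tau^d(t) = t, which forces v^(d) = 0 unless d = 0.  So I contains a
   power of y, and [x y^m - rho^m y^m x = v^(m) y^(m-1)] lowers it to 1. *)

(** * A module over an Ore extension, and top coefficients of products *)

Section OreModule.
Variables (B : nzRingType) (D : ore_datum B).
Local Notation s := (ore_auto D).
Local Notation d := (ore_der D).

(** The left module B[x; s, d]/B[x; s, d]x, identified with B: modulo left multiples of x, x b is
    d(b). *)
Definition ore_act (p : ore D) (b : B) : B :=
  \sum_(i < size (p : {poly B})) (p : {poly B})`_i * iter i d b.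

Lemma ore_actE n (p : ore D) b : (size (p : {poly B}) <= n)%N ->
  ore_act p b = \sum_(i < n) (p : {poly B})`_i * iter i d b.
Proof.
move=> le_pn; rewrite /ore_act -(subnKC le_pn) big_split_ord /=.
rewrite [X in _ = _ + X]big1 ?addr0 // => i _.
by rewrite nth_default ?mul0r // leq_addr.
Qed.

Lemma ore_actDl (p q : ore D) b : ore_act (p + q) b = ore_act p b + ore_act q b.
Proof.
pose n := maxn (size (p : {poly B})) (size (q : {poly B})).
rewrite !(@ore_actE n) ?leq_maxl ?leq_maxr ?size_polyD // -big_split /=.
by apply: eq_bigr => i _; rewrite coefD mulrDl.
Qed.

Lemma ore_act0 b : ore_act 0 b = 0.
Proof. by rewrite /ore_act size_poly0 big_ord0. Qed.

Lemma ore_actN (p : ore D) b : ore_act (- p) b = - ore_act p b.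
Proof. by apply/eqP; rewrite -addr_eq0 -ore_actDl addNr ore_act0. Qed.

Lemma ore_actZ c (p : {poly B}) b :
  ore_act (c *: p : {poly B}) b = c * ore_act p b.
Proof.
rewrite (@ore_actE (size p)) ?size_scale_leq // mulr_sumr.
by apply: eq_bigr => i _; rewrite coefZ mulrA.
Qed.

Lemma ore_actXn n b : ore_act ('X^n : {poly B}) b = iter n d b.
Proof.
rewrite /ore_act size_polyXn big_ord_recr /= coefXn eqxx mul1r.
by rewrite big1 ?add0r // => i _; rewrite coefXn ltn_eqF ?mul0r.
Qed.

Lemma ore_act_shift (p : {poly B}) b :
  ore_act (ore_shift D p : {poly B}) b = d (ore_act p b).
Proof.
elim/ore_ind: p => [|p q IHp IHq|c n].
- by rewrite ore_shift0 !ore_act0 raddf0.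
- by rewrite ore_shiftD (ore_actDl (ore_shift D p)) (ore_actDl p) raddfD IHp IHq.
rewrite ore_shiftZ ore_shiftXn ore_actDl !ore_actZ !ore_actXn.
by rewrite ore_derP.
Qed.

Lemma ore_actM (p q : ore D) b : ore_act (p * q) b = ore_act p (ore_act q b).
Proof.
elim/ore_ind: p => [|p p' IHp IHp'|c n].
- by rewrite mul0r !ore_act0.
- by rewrite mulrDl !ore_actDl IHp IHp'.
rewrite [_ * q]ore_mulZl !ore_actZ ore_mulXn ore_actXn; congr (_ * _).
by elim: n => //= n <-; rewrite ore_act_shift.
Qed.

(* The elements of B[x; s, d] mapping B into N form an ideal, so the faithfulness
   of the module B/N over a simple ring leaves no room for b. *)
Lemma ore_simple_left_ideal (N : B -> Prop) :
    simple_ring (ore D) ->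
    N 0 -> (forall a b, N a -> N b -> N (a - b)) ->
    (forall a b, N b -> N (a * b)) -> (forall b, N b -> N (d b)) ->
  forall b, b != 0 -> (forall c, N (b * c)) -> forall c, N c.
Proof.
move=> simR N0 NB NM Nd b b0 Nb.
have ND a c : N a -> N c -> N (a + c).
  by move=> Na Nc; rewrite -[c]opprK; apply: (NB) => //; rewrite -sub0r; apply: NB.
have Nact p c : N c -> N (ore_act p c).
  move=> Nc; apply: big_ind => // i _; apply: NM.
  by elim: (i : nat) => //= n; apply: Nd.
pose I (p : ore D) := forall c, N (ore_act p c).
have idI : is_ideal I.
  split=> [c|p q Ip Iq c|r p Ip c|r p Ip c].
  - by rewrite ore_act0.
  - by rewrite ore_actDl ore_actN; apply: NB.
  - by rewrite ore_actM; apply: Nact.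
  - by rewrite ore_actM.
have Ib : I (ore_const D b).
  by move=> c; rewrite /ore_const -alg_polyC ore_actZ (ore_actXn 0).
case: (simR I idI) => [I0|I1 c].
  have /eqP := (I0 _).1 Ib; rewrite [_ == _]polyC_eq0; by rewrite (negPf b0).
by have := I1 1 c; rewrite (ore_actXn 0).
Qed.

(** The [d]-part of [ore_shift] does not raise the degree, so only [s] reaches the top
    coefficient. *)
Lemma coef_iter_ore_shift n (q : {poly B}) m : (size q <= m.+1)%N ->
  (size (iter n (ore_shift D) q) <= (n + m).+1)%N
  /\ (iter n (ore_shift D) q)`_(n + m) = iter n s q`_m.
Proof.
move=> szq; elim: n => [|n [IHs IHc]] //=; set p := iter n _ q in IHs IHc *.
split.
  rewrite (leq_trans (size_polyD _ _)) // geq_max (leq_trans (size_polyMleq _ _)).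
    by rewrite (leq_trans (size_poly _ _)) // ltnW // ltnS addSn ltnS.
  by rewrite size_polyX addn2 /= addSn ltnS (leq_trans (size_poly _ _)).
rewrite coefD coefMX !coef_map /= IHc.
by rewrite [p`_(_)]nth_default ?raddf0 ?addr0 // addSn.
Qed.

Lemma coef_ore_mul_top (p q : {poly B}) n m :
    (size p <= n.+1)%N -> (size q <= m.+1)%N ->
  (ore_mul D p q)`_(n + m) = p`_n * iter n s q`_m.
Proof.
move=> szp szq; rewrite (ore_mulE _ _ szp) coef_sum big_ord_recr /=.
rewrite coefZ (coef_iter_ore_shift n szq).2 big1 ?add0r // => i _.
rewrite coefZ [X in _ * X]nth_default ?mulr0 //.
by apply: leq_trans (coef_iter_ore_shift i szq).1 _; rewrite ltn_add2r.
Qed.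

End OreModule.

(** * Stable simplicity and monic elements of least degree *)

Definition stable_simple (R : nzRingType) (s : R -> R) : Prop :=
  forall I : R -> Prop, is_ideal I -> (forall a, I a -> I (s a)) ->
  forall a, I a -> a != 0 -> I 1.

Lemma exists_min_size (R : nzRingType) (J : {poly R} -> Prop) f :
    J f -> f != 0 ->
  exists g, [/\ J g, g != 0
    & forall h, J h -> (size h < size g)%N -> h = 0].
Proof.
have [n] := ubnP (size f); elim: n f => // n IHn f szf Jf f0.
have [[h [Jh szh h0]]|noh] :=
  classic (exists h, [/\ J h, (size h < size f)%N & h != 0]).
  exact: IHn (leq_trans szh szf) Jh h0.
exists f; split=> // h Jh szh; apply/eqP/negPn/negP=> h0.
by apply: noh; exists h.
Qed.

(** For n the least degree, the coefficients of degree n of members of [J] of size at most n + 1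
    form a nonzero [s]-stable ideal, which therefore contains 1. *)
Lemma exists_min_monic (R : nzRingType) (s : R -> R) (J : {poly R} -> Prop) :
    stable_simple s ->
    (forall f g, J f -> J g -> J (f - g)) ->
    (forall c f, J f -> J (c *: f)) ->
    (forall n f c, J f -> (size f <= n.+1)%N ->
       exists g, [/\ J g, (size g <= n.+1)%N & g`_n = f`_n * c]) ->
    (forall n f, J f -> (size f <= n.+1)%N ->
       exists g, [/\ J g, (size g <= n.+1)%N & g`_n = s f`_n]) ->
  forall f, J f -> f != 0 ->
  exists g, [/\ J g, g \is monic
    & forall h, J h -> (size h < size g)%N -> h = 0].
Proof.
move=> simR JB JZ Jr Js f Jf /(exists_min_size Jf)[g [Jg g0 gmin]].
pose n := (size g).-1.
have szg : size g = n.+1 by rewrite prednK // lt0n size_poly_eq0.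
pose I a := exists h, [/\ J h, (size h <= n.+1)%N & h`_n = a].
have idI : is_ideal I.
  split=> [|_ _ [h [Jh szh <-]] [k [Jk szk <-]]|a _ [h [Jh szh <-]]|a _ [h [Jh szh <-]]].
  - by exists 0; rewrite size_poly0 coef0 -[X in J X](subrr f); split=> //; apply: JB.
  - exists (h - k); rewrite coefB; split=> //; first exact: JB.
    by rewrite (leq_trans (size_polyD _ _)) // size_polyN geq_max szh.
  - exists (a *: h); rewrite coefZ; split=> //; first exact: JZ.
    exact: leq_trans (size_scale_leq _ _) szh.
  - exact: Jr.
have [||| h [Jh szh hn]] := simR I idI _ g`_n _ _.
- by move=> _ [h [Jh szh <-]]; apply: Js.
- by exists g; rewrite szg.
- by rewrite -/(lead_coef g) lead_coef_eq0.
have szh' : size h = n.+1.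
  apply/eqP; rewrite eqn_leq szh ltnNge; apply/negP=> /leq_sizeP/(_ n (leqnn n)).
  by rewrite hn => /eqP; rewrite oner_eq0.
by exists h; rewrite monicE lead_coefE szh' hn eqxx -szg; split.
Qed.

Lemma lt_size_top_coef0 (R : nzRingType) (f : {poly R}) n :
  (size f <= n.+1)%N -> f`_n = 0 -> (size f < n.+1)%N.
Proof.
move=> szf fn0; rewrite ltnS; apply/leq_sizeP=> j.
rewrite leq_eqVlt => /predU1P[<- //|ltnj].
by rewrite nth_default // (leq_trans szf).
Qed.

Lemma iter_surj (T : Type) (s : T -> T) n :
  (forall b, exists c, s c = b) -> forall b, exists c, iter n s c = b.
Proof.
move=> surj; elim: n => [|n IHn] b /=; first by exists b.
by have [c <-] := surj b; have [e <-] := IHn c; exists e.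
Qed.

Definition twist (B : nzRingType) (s : B -> B) (f : {poly B}) (b : B) : {poly B} :=
  \poly_(i < size f) (f`_i * iter i s b).

Lemma coef_twist (B : nzRingType) (s : B -> B) (f : {poly B}) b i :
  (twist s f b)`_i = f`_i * iter i s b.
Proof.
rewrite coef_poly; case: ltnP => // le_fi.
by rewrite nth_default // mul0r.
Qed.

(* [B[y; s]] is only touched through the left normal forms [\sum_i f_i y^i] of
   an additive group [J] of polynomials; multiplying such a form by [y] on the
   left and cancelling one [y] on the right is [map_poly s], while multiplying
   by [b : B] on the right is [twist s ^~ b]. *)
Lemma stable_simple_skew (B : nzRingType) (s : {rmorphism B -> B})
    (J : {poly B} -> Prop) :
    stable_simple s -> (forall b, exists c, s c = b) ->
    (forall d, (0 < d)%N -> exists2 t, (forall b, t * b = b * t) & iter d s t <> t) ->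
    (forall f g, J f -> J g -> J (f - g)) ->
    (forall b f, J f -> J (b *: f)) ->
    (forall f b, J f -> J (twist s f b)) ->
    (forall f, J f -> J (map_poly s f)) ->
    (forall f : {poly B}, J (f * 'X) -> J f) ->
  forall f, J f -> f != 0 -> J 1.
Proof.
move=> simB surj outer JB JZ Jt Jm JX f Jf f0.
have surjn n := iter_surj n surj.
have sz_twist n (h : {poly B}) b : (size h <= n.+1)%N -> (size (twist s h b) <= n.+1)%N.
  by apply: leq_trans; apply: size_poly.
have sz_map n (h : {poly B}) : (size h <= n.+1)%N -> (size (map_poly s h) <= n.+1)%N.
  by apply: leq_trans; apply: size_poly.
have [n h b Jh szh|n h Jh szh|g [Jg mong gmin]] :=
  exists_min_monic simB JB JZ _ _ Jf f0.
- have [c <-] := surjn n b; exists (twist s h c).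
  by rewrite coef_twist; split; [apply: Jt|apply: sz_twist|].
- exists (map_poly s h).
  by rewrite coef_map; split; [apply: Jm|apply: sz_map|].
have [d szg] : exists d, size g = d.+1.
  by exists (size g).-1; rewrite prednK // lt0n size_poly_eq0 monic_neq0.
have gd : g`_d = 1 by move/monicP: mong; rewrite lead_coefE szg.
(* By minimality, a member of degree at most d without y^d term vanishes; the identities for [g]
   below come from such differences. *)
have zero h : J h -> (size h <= d.+1)%N -> h`_d = 0 -> h = 0.
  by move=> Jh szh hd0; apply: gmin; rewrite // szg; apply: lt_size_top_coef0.
have sgg : map_poly s g = g.
  apply/eqP; rewrite -subr_eq0; apply/eqP/zero; first by apply: (JB) => //; apply: Jm.
    by rewrite (leq_trans (size_polyD _ _)) // size_polyN geq_max sz_map ?szg /=.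
  by rewrite coefB coef_map /= gd rmorph1 subrr.
have gtw b : iter d s b *: g = twist s g b.
  apply/eqP; rewrite -subr_eq0; apply/eqP/zero.
  - by apply: JB; [apply: JZ|apply: Jt].
  - rewrite (leq_trans (size_polyD _ _)) // size_polyN geq_max.
    by rewrite -szg size_scale_leq /= szg sz_twist // szg.
  by rewrite coefB coefZ coef_twist gd mulr1 mul1r subrr.
have sg0 : s g`_0 = g`_0 by rewrite -[in RHS]sgg coef_map.
have g0M b : iter d s b * g`_0 = g`_0 * b.
  by have /(congr1 (fun h : {poly B} => h`_0)) := gtw b; rewrite coefZ coef_twist.
case: d => [|d] in szg gd zero gtw g0M *.
  by move: Jg; rewrite [g]size1_polyC ?szg // gd.
(* Otherwise a factor y cancels on the right and leaves a nonzero member of smaller degree. *)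
have g00 : g`_0 != 0.
  apply/eqP=> g00; have [h gE] : exists h, g = h * 'X.
    exists (\poly_(i < size g) g`_i.+1); apply/polyP=> i.
    rewrite coefMX; case: i => [|i] /=; first by rewrite g00.
    by rewrite coef_poly; case: ltnP => // /leqW; apply: nth_default.
  have h0 : h != 0.
    by apply: (contra_neq _ (monic_neq0 mong)) => h0; rewrite gE h0 mul0r.
  case/eqP: (h0); apply: gmin; last by rewrite gE size_mulX.
  by apply: JX; rewrite -gE.
(* The right ideal g_0 B is two-sided by [g0M], powers of [s] being surjective, and is stable since
   s(g_0) = g_0. *)
pose K a := exists b, a = g`_0 * b.
have idK : is_ideal K.
  split=> [|_ _ [a ->] [b ->]|r _ [b ->]|r _ [b ->]].
  - by exists 0; rewrite mulr0.
  - by exists (a - b); rewrite mulrBr.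
  - by have [c <-] := surjn d.+1 r; exists (c * b); rewrite mulrA g0M mulrA.
  - by exists (b * r); rewrite mulrA.
have [|||b gb] := simB K idK _ g`_0 _ _.
- by move=> _ [b ->]; exists (s b); rewrite rmorphM sg0.
- by exists 1; rewrite mulr1.
- exact: g00.
(* As t is central, s^(d+1)(t) g_0 = g_0 t = t g_0, and g_0 cancels because g_0 b = 1. *)
have [t tC []] := outer d.+1 isT.
by rewrite -[LHS]mulr1 -[RHS]mulr1 gb !mulrA g0M tC.
Qed.

(** * The endomorphism tau of A[t] and tau-simplicity *)

Section CommutingGenerator.
Variables (F : fieldType) (A : algType F) (D : ambiskew_datum A) (vi : A).
Local Notation alpha := (am_alpha D).
Local Notation gamma := (am_gamma D).
Local Notation v := (am_v D).
Local Notation rho := (am_rho D).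
Hypotheses (viv : vi * v = 1) (vvi : v * vi = 1).

(** From y x = rho^-1 v (t - 1) follows y t = alpha(v^-1) y x y = k (t - 1) y with this k. *)
Definition tau_coef : A := rho^-1 *: (alpha vi * v).
Definition tau_coef_inv : A := rho *: (vi * alpha v).
Local Notation k := tau_coef.
Local Notation ki := tau_coef_inv.

Lemma tau_coefK : k * ki = 1.
Proof.
rewrite -scalerAl -scalerAr scalerA mulVf ?am_rho_neq0 // scale1r.
by rewrite mulrA -(mulrA _ v) vvi mulr1 -rmorphM viv rmorph1.
Qed.

Lemma tau_coef_invK : ki * k = 1.
Proof.
rewrite -scalerAl -scalerAr scalerA mulfV ?am_rho_neq0 // scale1r.
by rewrite mulrA -(mulrA _ (alpha v)) -rmorphM vvi rmorph1 mulr1 viv.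
Qed.

Lemma v_normal a : v * a = gamma a * v.
Proof. exact: (am_normal D).1. Qed.

Lemma vi_normal a : vi * gamma a = a * vi.
Proof. by rewrite -[LHS]mulr1 -vvi mulrA -(mulrA vi) -v_normal mulrA viv mul1r. Qed.

(** Passing [a] across v applies gamma, and alpha(v^-1) undoes it because alpha and gamma
    commute. *)
Lemma tau_coefC a : k * a = a * k.
Proof.
rewrite -scalerAl -scalerAr -mulrA v_normal; congr (_ *: _).
rewrite -[in LHS](aut_invK alpha a) -am_comm !mulrA -rmorphM vi_normal.
by rewrite rmorphM /= aut_invK.
Qed.

Lemma tau_coef_invC a : ki * a = a * ki.
Proof.
rewrite -[LHS]mulr1 -tau_coefK !mulrA; congr (_ * _).
by rewrite -mulrA -tau_coefC mulrA tau_coef_invK mul1r.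
Qed.

Definition tau_X : {poly A} := k *: ('X - 1).

Fact tau_comm : commr_rmorph (polyC \o alpha) tau_X.
Proof.
move=> a; rewrite /tau_X -mul_polyC; apply/commr_sym/commrM.
  by rewrite /GRing.comm -!polyCM tau_coefC.
by apply: commrB; [apply: commr_polyX|apply: commr1].
Qed.

(* With [t = v^-1 x y], which commutes with A, one has [y b(t) = (tau b)(t) y]. *)
Definition tau : {poly A} -> {poly A} := horner_morph tau_comm.
HB.instance Definition _ := GRing.RMorphism.on tau.

Lemma tauC a : tau a%:P = (alpha a)%:P.
Proof. exact: horner_morphC. Qed.

Lemma tauX : tau 'X = tau_X.
Proof. exact: horner_morphX. Qed.

Lemma tau_surj b : exists c, tau c = b.
Proof.
elim/poly_ind: b => [|b a [c IHc]]; first by exists 0; rewrite raddf0.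
(* [tau] sends alpha^-1(k^-1) X + 1 to k^-1 k (X - 1) + 1 = X. *)
exists (c * ((aut_inv alpha ki)%:P * 'X + 1) + (aut_inv alpha a)%:P).
rewrite rmorphD rmorphM rmorphD rmorphM rmorph1 /= !tauC tauX !aut_invK IHc.
by rewrite mul_polyC scalerA tau_coef_invK scale1r subrK.
Qed.

Lemma tauZ a b : tau (a *: b) = alpha a *: tau b.
Proof. by rewrite -!mul_polyC rmorphM /= tauC. Qed.

(** Since rho alpha(v) k = v, rho tau(v X) = v X - v; iterating accumulates v^(d). *)
Lemma iter_tau_vX d :
  (rho ^+ d)%:A *: iter d tau (v *: 'X) = v *: 'X - (vpow D d)%:P.
Proof.
elim: d => [|d IHd]; first by rewrite vpow0 subr0 scale1r scale1r.
have -> : (rho ^+ d.+1)%:A *: iter d.+1 tau (v *: 'X)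
    = rho%:A *: tau ((rho ^+ d)%:A *: iter d tau (v *: 'X)) :> {poly A}.
  by rewrite tauZ linearZ rmorph1 scalerA -scalerAl mul1r scalerA -exprS.
have vk : rho%:A * (alpha v * k) = v.
  rewrite -scalerAr mulrA -rmorphM vvi rmorph1 mul1r mulr_algl.
  by rewrite scalerA mulfV ?am_rho_neq0 // scale1r.
rewrite IHd rmorphB /= tauZ tauX tauC scalerBr !scalerA -mulrA vk.
rewrite -add1n vpowD vpow1 scalerBr alg_polyC polyCD opprD addrA.
by rewrite -[X in _ - X = _]mul_polyC -polyCM mulr_algl.
Qed.

(** If X were fixed, tau^d(v X) = alpha^d(v) X would have no constant term, against the -v^(d) of
    [iter_tau_vX]. *)
Lemma iter_tau_X_neq d : vpow D d <> 0 -> iter d tau 'X <> 'X.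
Proof.
move=> vd0 fixX; apply: vd0.
have tauvX : iter d tau (v *: 'X) = iter d alpha v *: 'X.
  rewrite -[in RHS]fixX; elim: (d) => //= n ->; exact: tauZ.
have /(congr1 (fun b : {poly A} => b`_0)) := iter_tau_vX d.
rewrite tauvX coefB !coefZ coefX coefC eqxx !mulr0 sub0r => /eqP.
by rewrite eq_sym oppr_eq0 => /eqP.
Qed.

Lemma tau_MXaddC b a :
  tau (b * 'X + a%:P) = tau b * k%:P * 'X - tau b * k%:P + (alpha a)%:P.
Proof.
by rewrite rmorphD rmorphM /= tauC tauX /tau_X -mul_polyC mulrA mulrBr mulr1.
Qed.

Lemma size_MXaddC_leq (b : {poly A}) a n :
  (size (b * 'X + a%:P)%R <= n.+1)%N -> (size b <= n)%N.
Proof.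
move=> /leq_sizeP szb; apply/leq_sizeP=> i le_ni.
by have := szb i.+1 le_ni; rewrite coefD coefMX coefC addr0.
Qed.

Lemma size_tau (b : {poly A}) : (size (tau b) <= size b)%N.
Proof.
suff: forall n, (size b <= n)%N -> (size (tau b) <= n)%N by apply.
elim/poly_ind: b => [|b a IHb] [|n] szb; try by rewrite raddf0 size_poly0.
  by move: szb; rewrite size_poly_leq0 => /eqP->; rewrite raddf0 size_poly0.
apply/leq_sizeP=> i lt_ni; rewrite tau_MXaddC coefD coefB coefMX !coefMC coefC.
have tau0 j : (n <= j)%N -> (tau b)`_j = 0.
  by apply/leq_sizeP; apply: IHb; apply: size_MXaddC_leq szb.
by case: i lt_ni => // i le_ni; rewrite !tau0 ?mul0r ?subr0 ?addr0 // ltnW.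
Qed.

Lemma coef_tau_top (b : {poly A}) n : (size b <= n.+1)%N ->
  (tau b)`_n = alpha b`_n * k ^+ n.
Proof.
elim/poly_ind: b n => [|b a IHb] n szb.
  by rewrite raddf0 !coef0 raddf0 mul0r.
have {}szb := size_MXaddC_leq szb.
rewrite tau_MXaddC !coefD coefN !coefMX !coefMC !coefC.
case: n szb => [|n] szb /=.
  move: szb; rewrite size_poly_leq0 => /eqP->.
  by rewrite raddf0 coef0 mul0r subr0 !add0r mulr1.
rewrite (IHb _ szb) [(tau b)`_n.+1]nth_default ?(leq_trans (size_tau b)) //.
by rewrite mul0r subr0 !addr0 -mulrA -exprSr.
Qed.

(** The factor -(n + 1) is the X^n coefficient of (X - 1)^(n+1), which arises from the top term of
    [b]. *)
Lemma coef_tau_next (b : {poly A}) n : (size b <= n.+2)%N ->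
  (tau b)`_n = alpha b`_n * k ^+ n - (alpha b`_n.+1 * k ^+ n.+1) *+ n.+1.
Proof.
elim/poly_ind: b n => [|b a IHb] n szb.
  by rewrite raddf0 !coef0 raddf0 !mul0r mul0rn subr0.
have {}szb := size_MXaddC_leq szb.
rewrite tau_MXaddC !coefD coefN !coefMX !coefMC !coefC /=.
case: n szb => [|n] szb /=.
  by rewrite coef_tau_top // !mulr1 !add0r !addr0 addrC.
rewrite (IHb _ szb) (coef_tau_top szb) !addr0 mulrBl -!mulrA -exprSr.
by rewrite mulrnAl -mulrA -exprSr -addrA -opprD -mulrSr.
Qed.

Lemma tau_simple : [pchar F] =i pred0 -> alpha_simple alpha -> singular D ->
  stable_simple tau.
Proof.
move=> charF0 simA singD I [I0 IB IMl IMr] Itau f If f0.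
have IZ a g : I g -> I (a *: g) by rewrite -mul_polyC; apply: IMl.
have kiXk n : k ^+ n * ki ^+ n = 1.
  rewrite -exprMn_comm ?tau_coefK ?expr1n //; exact: tau_coefC.
have simA' : stable_simple alpha.
  move=> K idK Kalpha a Ka a0; have [K0|//] := simA K (conj idK Kalpha).
  by move/K0: Ka a0 => ->; rewrite eqxx.
have [n g a Ig szg|n g Ig szg|g [Ig mong gmin]] :=
  exists_min_monic simA' IB IZ _ _ If f0.
- exists (g * a%:P); rewrite coefMC; split=> //; first exact: IMr.
  rewrite (leq_trans (size_polyMleq _ _)) // size_polyC.
  by case: (a == 0); rewrite /= ?addn0 ?addn1 // (leq_trans (leq_pred _)).
(* The factor k^-n cancels the k^n that [tau] puts on the coefficient of degree n. *)
- exists (tau g * (ki ^+ n)%:P); split; first exact/IMr/Itau.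
    rewrite (leq_trans (size_polyMleq _ _)) // size_polyC.
    have := leq_trans (size_tau g) szg.
    by case: (_ == 0); rewrite /= ?addn0 ?addn1 // => /(leq_trans (leq_pred _)).
  by rewrite coefMC coef_tau_top // -mulrA kiXk mulr1.
have [n szg] : exists n, size g = n.+1.
  by exists (size g).-1; rewrite prednK // lt0n size_poly_eq0 monic_neq0.
have gn : g`_n = 1 by move/monicP: mong; rewrite lead_coefE szg.
have zero h : I h -> (size h <= n.+1)%N -> h`_n = 0 -> h = 0.
  by move=> Ih szh hn0; apply: gmin; rewrite // szg; apply: lt_size_top_coef0.
case: n => [|n] in szg gn zero *.
  by move: Ig; rewrite [g]size1_polyC ?szg // gn.
exfalso; apply: singD.
have gC a i : g`_i * a = a * g`_i.
  suff /(congr1 (fun h : {poly A} => h`_i)) : g * a%:P - a *: g = 0.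
    by rewrite coefB coefMC coefZ coef0 => /eqP; rewrite subr_eq0 => /eqP.
  apply: zero; first by apply: (IB); [apply: IMr|apply: IZ].
    apply/leq_sizeP=> j le_nj; rewrite coefB coefMC coefZ.
    by rewrite nth_default ?szg // mul0r mulr0 subrr.
  by rewrite coefB coefMC coefZ gn mulr1 mul1r subrr.
have tg : tau g - k ^+ n.+1 *: g = 0.
  apply: zero; first by apply: (IB); [apply: Itau|apply: IZ].
    rewrite (leq_trans (size_polyD _ _)) // size_polyN geq_max -szg.
    by rewrite size_tau size_scale_leq.
  by rewrite coefB coefZ coef_tau_top ?szg // gn rmorph1 mulr1 mul1r subrr.
(* With c the coefficient of X^n in [g], comparing these coefficients in tau(g) = k^(n+1) g and
   cancelling k^(n+1) gives alpha(c) k^-1 - c = n + 1. *)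
have /(congr1 (fun h : {poly A} => h`_n)) := tg.
rewrite coefB coefZ coef_tau_next ?szg // gn rmorph1 mul1r coef0.
move/(congr1 (fun a => a * ki ^+ n.+1)).
rewrite mul0r !mulrBl mulrnAl kiXk -(gC (k ^+ _)) -(mulrA g`_n) kiXk mulr1.
rewrite exprSr mulrA -(mulrA _ (k ^+ n)) kiXk mulr1.
move: g`_n (gC^~ n) => c cC /eqP; rewrite subr_eq0 => /eqP cE.
have {}cE : alpha c * ki - c = n.+1%:R.
  by apply/eqP; rewrite subr_eq addrC -subr_eq; apply/eqP.
pose N : F := n.+1%:R.
have N0 : N != 0.
  by rewrite /N ((pcharf0P F).1 charF0).
(* As k^-1 = rho v^-1 alpha(v), one has rho alpha(v c) = v alpha(c) k^-1, so v c - rho alpha(v c) =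
   -(n + 1) v. *)
exists (- N^-1 *: (v * c)); last first.
  rewrite [alpha _](iter_alphaZ D 1) /= scalerA (mulrC rho) -scalerA -scalerBr rmorphM.
  have -> : v * c - rho *: (alpha v * alpha c) = v * (c - alpha c * ki).
    by rewrite mulrBr -tau_coef_invC -scalerAl -scalerAr !mulrA vvi mul1r.
  rewrite -opprB cE mulrN scaleNr scalerN opprK mulr_natr.
  by rewrite -scaler_nat scalerA mulVf // scale1r.
have cG : gamma c = c.
  by rewrite -[LHS]mulr1 -vvi mulrA -v_normal -mulrA cC mulrA vvi mul1r.
split=> [a|]; last by rewrite linearZ rmorphM /= cG (am_normal D).2.
by rewrite -scalerAl -scalerAr -mulrA cC !mulrA v_normal.
Qed.
End CommutingGenerator.

(** * Commutation relations in R, and the proper ideal of a conformal tuple *)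

Section AmbiskewRelations.
Variables (F : fieldType) (A : algType F) (D : ambiskew_datum A).
Local Notation alpha := (am_alpha D).
Local Notation gamma := (am_gamma D).
Local Notation v := (am_v D).
Local Notation rho := (am_rho D).
Local Notation R := (ambiskew D).
Local Notation C := (am_const D).
Local Notation x := (am_x D).
Local Notation y := (am_y D).
Local Notation sD := (skew_poly_datum D).
Local Notation aD := (ambiskew_ore_datum D).

Fact am_const_zmod : zmod_morphism C.
Proof. by move=> a b; rewrite /am_const /ore_const !polyCB. Qed.
HB.instance Definition _ := GRing.isZmodMorphism.Build A R C am_const_zmod.

Fact am_const_monoid : monoid_morphism C.
Proof. by split=> // a b; rewrite /am_const !ore_constM. Qed.
HB.instance Definition _ := GRing.isMonoidMorphism.Build A R C am_const_monoid.

(** Elements are sums of normal forms a y^j x^n, each built from 1 by left multiplications alone. *)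
Lemma am_ind (P : R -> Prop) :
    P 1 -> (forall p q, P p -> P q -> P (p + q)) ->
    (forall a p, P p -> P (C a * p)) -> (forall p, P p -> P (y * p)) ->
    (forall p, P p -> P (x * p)) ->
  forall p, P p.
Proof.
move=> P1 PD PC Py Px.
have P0 : P 0 by rewrite -(mul0r 1) -(rmorph0 C); apply: PC.
have Pxn n : P ('X^n : {poly skew_poly D}).
  elim: n => [|n IHn]; first by rewrite expr0.
  by have := Px _ IHn; rewrite [x * _](ore_mulXn _ 1) /= ore_shiftXn.
elim/ore_ind => // p n.
elim/ore_ind: p => [|p q IHp IHq|a j].
- by rewrite scale0r.
- by rewrite scalerDl; apply: PD.
have -> : ((a *: 'X^j : {poly A}) : skew_poly D) *: ('X^n : {poly skew_poly D})
    = C a * (y ^+ j * ('X^n : {poly skew_poly D})) :> {poly skew_poly D}.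
  rewrite [C a * _]ore_mulC.
  have -> : y ^+ j * ('X^n : {poly skew_poly D})
      = (('X^j : {poly A}) : skew_poly D) *: ('X^n : {poly skew_poly D}).
    elim: j => [|j IHj]; first by rewrite expr0 mul1r expr0 scale1r.
    rewrite exprS -mulrA IHj [y * _]ore_mulC scalerA; congr (_ *: _).
    by rewrite [LHS](ore_mulXn _ 1) /= ore_shiftXn.
  by rewrite scalerA; congr (_ *: _); rewrite [RHS]ore_mulC.
apply: PC; elim: j => [|j IHj]; first by rewrite mul1r.
by rewrite exprS -mulrA; apply: Py.
Qed.

Lemma am_constZ (c : F) a : C (c *: a) = C c%:A * C a.
Proof. by rewrite -rmorphM /= mulr_algl. Qed.

Lemma am_scalarC (c : F) r : C c%:A * r = r * C c%:A.
Proof.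
elim/am_ind: r => [|p q IHp IHq|a p IHp|p IHp|p IHp].
- by rewrite mulr1 mul1r.
- by rewrite mulrDl mulrDr IHp IHq.
- rewrite mulrA -rmorphM -mulrA -IHp mulrA -rmorphM; congr (C _ * _).
  by rewrite mulr_algl mulr_algr.
- rewrite -mulrA -IHp !mulrA am_yM; congr (C _ * _ * _).
  by rewrite [RHS](iter_alphaZ D 1) /= rmorph1.
- rewrite -mulrA -IHp !mulrA am_xM; congr (C _ * _ * _).
  by rewrite linearZ /= rmorph1.
Qed.

Lemma am_yX m a : y ^+ m * C a = C (iter m alpha a) * y ^+ m.
Proof.
elim: m a => [|m IHm] a; first by rewrite mul1r mulr1.
by rewrite exprS -mulrA IHm mulrA am_yM -mulrA.
Qed.

(** Each further y creates rho^(m+1) y^(m+1) v; moving v left past y^(m+1) yields the next summand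
    of v^(m+2). *)
Lemma am_xyX m :
  x * y ^+ m.+1 = C (rho ^+ m.+1)%:A * y ^+ m.+1 * x + C (vpow D m.+1) * y ^+ m.
Proof.
elim: m => [|m IHm]; first by rewrite !expr1 am_xy vpow1 mulr1.
have -> : C (vpow D m.+2)
    = C (vpow D m.+1) + C (rho ^+ m.+1)%:A * C (iter m.+1 alpha v).
  by rewrite -addn1 vpowD vpow1 rmorphD /= am_constZ.
rewrite [y ^+ m.+2]exprSr mulrA IHm [LHS]mulrDl -[C _ * _ * y]mulrA -exprSr.
rewrite -[_ * x * y]mulrA am_xy mulrDr mulrDl addrAC -!addrA; congr (_ + _); last first.
  by congr (_ + _); rewrite -!mulrA am_yX.
rewrite !mulrA -[_ * y ^+ m.+1 * _]mulrA -am_scalarC -!mulrA mulrA -rmorphM.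
by rewrite /= mulr_algl scalerA -exprSr.
Qed.

Lemma iter_alpha1 n : iter n alpha 1 = 1.
Proof. by elim: n => //= n ->; rewrite rmorph1. Qed.

(** [A] may have zero divisors, but a nonzero scalar is fixed by alpha and cancels, so the product
    of leading coefficients survives. *)
Lemma skew_mul_neq0 (p q : {poly A}) m (c : F) :
    p != 0 -> (size q <= m.+1)%N -> q`_m = c%:A -> c != 0 ->
  ore_mul sD p q != 0.
Proof.
move=> p0 szq qm c0; apply: contra_neq p0 => pq0.
apply/eqP; rewrite -lead_coef_eq0; apply/eqP.
have szp : (size p <= (size p).-1.+1)%N := leqSpred _.
have := coef_ore_mul_top sD szp szq.
rewrite pq0 coef0 qm iter_alphaZ -/(lead_coef p).
rewrite iter_alpha1 mulr_algr => /(congr1 (fun a => c^-1 *: a)).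
by rewrite scaler0 scalerA mulVf // scale1r.
Qed.

Lemma coef_mul_top_neq0 (p q : {poly skew_poly D}) m (c : F) :
    p != 0 -> (size q <= m.+1)%N ->
    q`_m = (c%:A *: 'X : {poly A}) -> c != 0 ->
  (ore_mul aD p q)`_((size p).-1 + m) != 0.
Proof.
move=> p0 szq qm c0; rewrite (coef_ore_mul_top aD (leqSpred _) szq) qm /=.
have -> n : iter n (@beta_ext _ _ D) (c%:A *: 'X : {poly A})
    = ((rho ^+ n * c)%:A *: 'X : {poly A}).
  elim: n => [|n /= ->]; first by rewrite mul1r.
  have := beta_ext_mono D ((rho ^+ n * c)%:A) 1; rewrite !expr1 => ->.
  by rewrite linearZ /= rmorph1 scalerA mulrA -exprS.
apply: (@skew_mul_neq0 _ _ 1 (rho ^+ (size p).-1 * c)).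
- by move: p0; rewrite -lead_coef_eq0.
- by rewrite (leq_trans (size_scale_leq _ _)) // size_polyX.
- by rewrite coefZ coefX mulr1.
- by rewrite mulf_neq0 ?expf_neq0 ?am_rho_neq0.
Qed.

Lemma am_mulyI (p : R) : p * y = 0 -> p = 0.
Proof.
move=> py0; apply/eqP/negPn/negP=> p0.
suff: (ore_mul aD p y)`_((size (p : {poly skew_poly D})).-1 + 0) != 0.
  by rewrite -[ore_mul _ _ _]/(p * y) py0 coef0 eqxx.
apply: (coef_mul_top_neq0 p0 _ _ (oner_neq0 F)); first exact: size_polyC_leq1.
by rewrite coefC /= !scale1r.
Qed.

Lemma conformal_not_simple : conformal D -> ~ simple_ring R.
Proof.
case=> u [uC gu] vE simR.
(* This sign gives v + w = rho alpha(w), hence z = xy + w = rho (yx + alpha(w)); comparing the two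
   forms moves z past x and y up to scalars. *)
pose w := - u; pose z : R := x * y + C w.
have wC a : w * a = gamma a * w by rewrite mulrN mulNr uC.
have vw : v + w = rho *: alpha w.
  by rewrite vE rmorphN scalerN addrAC subrr add0r.
have zE : z = C rho%:A * y * x + C (rho *: alpha w).
  by rewrite /z am_xy -addrA -rmorphD vw.
have zyx : z = C rho%:A * (y * x + C (alpha w)).
  by rewrite zE am_constZ mulrDr mulrA.
have zC a : z * C a = C (gamma a) * z.
  rewrite mulrDl mulrDr -!rmorphM /= wC -mulrA am_yM !mulrA am_xM.
  by rewrite beta_alpha.
have zy : z * y = C rho%:A * y * z.
  rewrite [in LHS]zyx -[LHS]mulrA -[RHS]mulrA; congr (_ * _).
  by rewrite mulrDl mulrDr mulrA am_yM -mulrA.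
have zx : z * x = C rho^-1%:A * x * z.
  rewrite [in RHS]zyx -[RHS]mulrA [x * (_ * _)]mulrA -am_scalarC !mulrA -rmorphM.
  rewrite /= mulr_algl scalerA mulVf ?am_rho_neq0 // scale1r rmorph1 mul1r.
  rewrite mulrDl mulrDr !mulrA am_xM beta_alpha; congr (_ + C _ * _).
  by rewrite rmorphN /= gu.
have zpoly : z = ((rho%:A *: 'X : {poly A}) : skew_poly D) *: ('X : {poly skew_poly D})
      + C (rho *: alpha w) :> {poly skew_poly D}.
  rewrite zE /am_const /am_y -ore_constM; congr (_ + _); rewrite [LHS]ore_mulC.
  by rewrite [ore_const _ _ * _]ore_mulC.
clearbody z.
have zR r : exists r', z * r = r' * z.
  elim/am_ind: r => [|p q [p' IHp] [q' IHq]|a p [p' IHp]|p [p' IHp]|p [p' IHp]].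
  - by exists 1; rewrite mulr1 mul1r.
  - by exists (p' + q'); rewrite mulrDr mulrDl IHp IHq.
  - by exists (C (gamma a) * p'); rewrite mulrA zC -!mulrA IHp.
  - by exists (C rho%:A * y * p'); rewrite mulrA zy -!mulrA IHp.
  - by exists (C rho^-1%:A * x * p'); rewrite mulrA zx -!mulrA IHp.
pose I (r : R) := exists p, r = p * z.
have idI : is_ideal I.
  split=> [|_ _ [p ->] [q ->]|r _ [p ->]|r _ [p ->]].
  - by exists 0; rewrite mul0r.
  - by exists (p - q); rewrite mulrBl.
  - by exists (r * p); rewrite mulrA.
  - by have [r' zr] := zR r; exists (p * r'); rewrite -mulrA zr mulrA.
(* A nonzero p gives p z a nonzero coefficient in positive x-degree, so p z is never 1. *)
have top p : p != 0 :> R -> (p * z : {poly _})`_((size (p : {poly _})).-1 + 1) != 0.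
  move=> p0; apply: (@coef_mul_top_neq0 p z 1 rho p0 _ _ (am_rho_neq0 D)).
    rewrite zpoly (leq_trans (size_polyD _ _)) // geq_max.
    rewrite (leq_trans (size_scale_leq _ _)) ?size_polyX //.
    by rewrite (leq_trans (size_polyC_leq1 _)).
  by rewrite zpoly coefD coefZ coefX coefC /= mulr1 addr0.
case: (simR I idI) => [I0|/(_ 1)[p p1]].
  have z0 : z = 0 by apply/I0; exists 1; rewrite mul1r.
  by have := top 1 (oner_neq0 _); rewrite z0 mulr0 coef0 eqxx.
have p0 : p != 0 by apply: contra_eq_neq p1 => ->; rewrite mul0r oner_neq0.
by have := top p p0; rewrite -p1 addn1 coef1 eqxx.
Qed.

End AmbiskewRelations.

(** * Forms in t and y, and simplicity of R *)

Section Sufficiency.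
Variables (F : fieldType) (A : algType F) (D : ambiskew_datum A) (vi : A).
Local Notation alpha := (am_alpha D).
Local Notation gamma := (am_gamma D).
Local Notation v := (am_v D).
Local Notation rho := (am_rho D).
Local Notation R := (ambiskew D).
Local Notation C := (am_const D).
Local Notation x := (am_x D).
Local Notation y := (am_y D).
Hypotheses (viv : vi * v = 1) (vvi : v * vi = 1).
Local Notation tau := (tau viv vvi).

Definition am_t : R := C vi * x * y.

(** Moving [a] left past y and x produces beta(alpha(a)) = gamma(a), which v^-1 turns back into
    [a]. *)
Fact am_t_comm : commr_rmorph C am_t.
Proof.
move=> a; rewrite /GRing.comm /am_t /= -[LHS]mulrA am_yM !mulrA -[C vi * x * _]mulrA.
by rewrite am_xM beta_alpha mulrA -!rmorphM (vi_normal viv vvi).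
Qed.

Definition am_phi : {poly A} -> R := horner_morph am_t_comm.
HB.instance Definition _ := GRing.RMorphism.on am_phi.
Local Notation phi := am_phi.

Lemma am_phiC a : phi a%:P = C a.
Proof. exact: horner_morphC. Qed.

Lemma am_phiX : phi 'X = am_t.
Proof. exact: horner_morphX. Qed.

Lemma am_vt : C v * am_t = x * y.
Proof. by rewrite /am_t !mulrA -rmorphM vvi rmorph1 mul1r. Qed.

Lemma am_y_phi b : y * phi b = phi (tau b) * y.
Proof.
elim/poly_ind: b => [|b a IHb]; first by rewrite !rmorph0 mulr0 mul0r.
have vt1 : C v * phi ('X - 1) = C rho%:A * y * x.
  rewrite rmorphB rmorph1 /= am_phiX mulrBr am_vt mulr1 am_xy.
  by rewrite addrK.
have yt : y * am_t = phi (tau 'X) * y.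
  rewrite tauX /tau_X -mul_polyC rmorphM /= am_phiC.
  have -> : C (tau_coef D vi) = C (rho^-1 *: alpha vi) * C v.
    by rewrite -rmorphM /= -scalerAl.
  rewrite -[C _ * C v * _]mulrA vt1 !mulrA -rmorphM /= mulr_algr scalerA.
  by rewrite mulfV ?am_rho_neq0 // scale1r am_yM.
rewrite !rmorphD !rmorphM /= tauC !am_phiC am_phiX mulrDr mulrDl mulrA IHb.
by rewrite -!mulrA yt am_yM.
Qed.

Lemma am_yX_phi k b : y ^+ k * phi b = phi (iter k tau b) * y ^+ k.
Proof.
elim: k b => [|k IHk] b; first by rewrite mul1r mulr1.
by rewrite exprSr -mulrA am_y_phi mulrA IHk -mulrA -exprSr iterSr.
Qed.

(** Horner evaluation keeps the coefficients on the left; with [R] noncommutative the map is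
    additive but need not be multiplicative. *)
Definition am_form (f : {poly {poly A}}) : R := (map_poly phi f).[y].

Lemma am_formD f g : am_form (f + g) = am_form f + am_form g.
Proof. by rewrite /am_form rmorphD hornerD. Qed.

Lemma am_formB f g : am_form (f - g) = am_form f - am_form g.
Proof. by rewrite /am_form rmorphB hornerD hornerN. Qed.

Lemma am_formC b : am_form b%:P = phi b.
Proof. by rewrite /am_form map_polyC hornerC. Qed.

Lemma am_formMX f : am_form (f * 'X) = am_form f * y.
Proof. by rewrite /am_form rmorphM /= map_polyX hornerMX. Qed.

Lemma am_formMXn f n : am_form (f * 'X^n) = am_form f * y ^+ n.
Proof.
elim: n => [|n IHn]; first by rewrite !mulr1.
by rewrite !exprSr mulrA am_formMX IHn mulrA.
Qed.

Lemma am_formZ b f : am_form (b *: f) = phi b * am_form f.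
Proof. by rewrite /am_form map_polyZ hornerZ. Qed.

Lemma am_y_form f : y * am_form f = am_form (map_poly tau f) * y.
Proof.
elim/poly_ind: f => [|f b IHf].
  by rewrite rmorph0 -polyC0 am_formC rmorph0 mulr0 mul0r.
rewrite rmorphD rmorphM /= map_polyX map_polyC !am_formD !am_formMX !am_formC.
by rewrite mulrDr mulrDl mulrA IHf am_y_phi.
Qed.

Lemma am_form_phi f b : am_form f * phi b = am_form (twist tau f b).
Proof.
elim/poly_ind: f b => [|f c IHf] b.
  by rewrite /twist size_poly0 poly_def big_ord0 -polyC0 am_formC rmorph0 mul0r.
have -> : twist tau (f * 'X + c%:P) b = twist tau f (tau b) * 'X + (c * b)%:P.
  apply/polyP=> i; rewrite coefD coefMX !coef_twist coefD coefMX !coefC.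
  case: i => [|i] /=; first by rewrite !add0r.
  by rewrite !addr0 -iterS iterSr.
rewrite !am_formD !am_formMX !am_formC mulrDl -mulrA am_y_phi mulrA IHf.
by rewrite rmorphM.
Qed.

(** A trailing y absorbs the leading x: if tau(c) = b, then x b(t) y = x y c(t) = v t c(t). *)
Lemma am_x_form f : exists g, x * am_form f * y = am_form g.
Proof.
elim/poly_ind: f => [|f b [g IHf]].
  by exists 0; rewrite -polyC0 am_formC rmorph0 mulr0 mul0r.
have [c cb] := tau_surj viv vvi b.
exists (g * 'X + (v%:P * 'X * c)%:P).
rewrite !am_formD !am_formMX !am_formC mulrDr mulrDl mulrA IHf.
rewrite -[x * phi b * y]mulrA -cb -am_y_phi mulrA -am_vt.
by rewrite !rmorphM /= am_phiC am_phiX.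
Qed.

Lemma am_form_surj (r : R) : exists n f, r * y ^+ n = am_form f.
Proof.
elim/am_ind: r => [|p q [n [f pf]] [m [g qg]]|a p [n [f pf]]|p [n [f pf]]|p [n [f pf]]].
- by exists 0, 1; rewrite mulr1 am_formC rmorph1.
- exists (n + m)%N, (f * 'X^m + g * 'X^n).
  rewrite mulrDl am_formD !am_formMXn -pf -qg -!mulrA -!exprD.
  by rewrite (addnC m).
- by exists n, (a%:P *: f); rewrite -mulrA pf am_formZ am_phiC.
- by exists n, (map_poly tau f * 'X); rewrite -mulrA pf am_formMX am_y_form.
have [g gE] := am_x_form f.
by exists n.+1, g; rewrite exprSr !mulrA -[x * p * _]mulrA pf gE.
Qed.

Lemma ambiskew_simple : [pchar F] =i pred0 -> alpha_simple alpha -> singular D ->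
  (forall m, (1 <= m)%N -> is_unit (vpow D m)) -> simple_ring R.
Proof.
move=> charF0 simA singD unitv I [I0 IB IMl IMr].
have [[r [Ir r0]]|noI] := classic (exists r, I r /\ r != 0); last first.
  left=> r; split=> [Ir|-> //]; apply/eqP/negPn/negP=> r0.
  by apply: noI; exists r.
right; suff I1 : I 1 by move=> a; rewrite -[a]mulr1; apply: IMl.
have [n [f rf]] := am_form_surj r.
(* Leaving the power of y free allows a factor y to be cancelled on the right within [J]. *)
pose J f := exists k, I (am_form f * y ^+ k).
have raise (p : R) k l : I (p * y ^+ k) -> I (p * y ^+ (k + l)).
  by move=> Ip; rewrite exprD mulrA; apply: IMr.
have f0 : f != 0.
  apply: contra_neq r0 => f0; move: rf.
  rewrite f0 -polyC0 am_formC rmorph0.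
  elim: n => [|n IHn]; first by rewrite mulr1.
  by rewrite exprSr mulrA => /am_mulyI.
have Jf : J f by exists 0%N; rewrite -rf mulr1; apply: IMr.
have [k] : J 1.
  have simB : stable_simple tau := tau_simple charF0 simA singD.
  apply: (stable_simple_skew (J := J) simB _ _ _ _ _ _ _ Jf f0).
  - exact: tau_surj.
  - move=> d d0; exists 'X => [b|]; first by rewrite commr_polyX.
    apply: iter_tau_X_neq => vd0; have [b [_]] := unitv d d0.
    by rewrite vd0 mul0r => /eqP; rewrite eq_sym oner_eq0.
  - move=> g h [k Ig] [l Ih]; exists (k + l)%N; rewrite am_formB mulrBl.
    by apply: IB; [apply: raise|rewrite addnC; apply: raise].
  - by move=> b g [k Ig]; exists k; rewrite am_formZ -mulrA; apply: IMl.
  - move=> g b [k Ig]; exists k; rewrite -am_form_phi.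
    (* Writing b as tau^k(c) lets it pass the power of y: b(t) y^k = y^k c(t). *)
    have [c <-] := iter_surj k (tau_surj viv vvi) b.
    by rewrite -mulrA -am_yX_phi mulrA; apply: IMr.
  - move=> g [k Ig]; exists k.+1.
    by rewrite exprS mulrA -am_y_form -mulrA; apply: IMl.
  - by move=> g [k Ig]; exists k.+1; rewrite exprS mulrA -am_formMX.
(* Now y^k lies in [I]; as each v^(k+1) is a unit, the relation for x y^(k+1) lowers the exponent
   one step at a time. *)
rewrite am_formC rmorph1 mul1r; elim: k => [//|k IHk] Iy; apply: IHk.
have [b [bv _]] := unitv k.+1 isT.
have -> : y ^+ k = C b * (x * y ^+ k.+1 - C (rho ^+ k.+1)%:A * y ^+ k.+1 * x).
  rewrite am_xyX addrAC subrr add0r mulrA -rmorphM bv.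
  by rewrite rmorph1 mul1r.
by apply/IMl/IB; [apply: IMl|apply/IMr/IMl].
Qed.

End Sufficiency.

(** * Necessity of alpha-simplicity and of the units v^(m) *)

Section Necessity.
Variables (F : fieldType) (A : algType F) (D : ambiskew_datum A).
Local Notation alpha := (am_alpha D).
Local Notation gamma := (am_gamma D).
Local Notation v := (am_v D).
Local Notation rho := (am_rho D).
Local Notation R := (ambiskew D).
Local Notation sD := (skew_poly_datum D).

Lemma iter_alphaB n a b : iter n alpha (a - b) = iter n alpha a - iter n alpha b.
Proof. by elim: n => //= n ->; rewrite raddfB. Qed.

Lemma beta_vpow m a : beta D (alpha a) * vpow D m = vpow D m * a.
Proof. by rewrite beta_alpha vpow_normal. Qed.

Lemma coef_skew_mul (p q : {poly A}) (K : nat -> A -> Prop) :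
    (forall i, K i 0) -> (forall i a b, K i a -> K i b -> K i (a + b)) ->
    (forall i a b, K i b -> K i (a * b)) ->
    (forall i b, K i b -> K i.+1 (alpha b)) ->
  (forall i, K i q`_i) -> forall i, K i (ore_mul sD p q)`_i.
Proof.
move=> K0 KD KM Ka Kq i; rewrite /ore_mul coef_sum; apply: big_ind => [//|a b|j _].
  exact: KD.
rewrite coefZ; apply: KM; elim: (j : nat) i => [|n IHn] i //=.
rewrite coefD coefMX !coef_map /= addr0.
by case: i => [|i] //=; apply: Ka.
Qed.

(* [A[y; alpha]] is the module R/Rx, with [x] acting as [delta]; the hypotheses
   on [K] say that [\sum_i K_i y^i] is a submodule. *)
Lemma simple_submodule (K : nat -> A -> Prop) :
    simple_ring R ->
    (forall i, K i 0) -> (forall i a b, K i a -> K i b -> K i (a - b)) ->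
    (forall i a b, K i b -> K i (a * b)) ->
    (forall i b, K i b -> K i.+1 (alpha b)) ->
    (forall i b, K i.+1 (alpha b) -> K i (vpow D i.+1 * b)) ->
  forall p : {poly A}, p != 0 ->
    (forall (q : {poly A}) i, K i (ore_mul sD p q)`_i) -> forall i, K i 1.
Proof.
move=> simR K0 KB KM Ka Kv p p0 Kp i.
have KD j a b : K j a -> K j b -> K j (a + b).
  move=> Ka1 Kb; rewrite -[b]opprK; apply: (KB) => //.
  by rewrite -sub0r; apply: KB.
pose N (q : skew_poly D) := forall i, K i (q : {poly A})`_i.
have NT : forall q, N q.
  apply: (ore_simple_left_ideal (N := N) simR _ _ _ _ p0 Kp).
  - by move=> j; rewrite coef0.
  - by move=> q r Nq Nr j; rewrite coefB; apply: KB.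
  - by move=> q r Nr j; apply: coef_skew_mul.
  move=> q Nq j; rewrite /= coef_delta.
  (* With the coefficient written as alpha(b), beta(alpha(b)) v^(j+1) becomes v^(j+1) b, as in
     [Kv]. *)
  rewrite -(aut_invK alpha ((q : {poly A})`_j.+1)) beta_vpow.
  by apply: Kv; rewrite aut_invK; apply: Nq.
by have := NT ('X^i : {poly A}) i; rewrite coefXn eqxx.
Qed.

Lemma simple_alpha_simple : simple_ring R -> alpha_simple alpha.
Proof.
move=> simR I [[I0 IB IMl IMr] Ia].
have [[a [Ia0 a0]]|noI] := classic (exists a, I a /\ a != 0); last first.
  left=> a; split=> [Ia1|-> //]; apply/eqP/negPn/negP=> a0.
  by apply: noI; exists a.
right; suff I1 : I 1 by move=> b; rewrite -[b]mulr1; apply: IMl.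
have up n m b : I (iter n alpha b) -> I (iter (m + n) alpha b).
  by move=> Ib; rewrite iterD; elim: m => //= m; apply: Ia.
(* [I] need not be closed under alpha^-1, which stability under x would require; its saturation
   is. *)
pose K (i : nat) b := exists n, I (iter n alpha b).
have [|||||||n] := @simple_submodule K simR _ _ _ _ _ a%:P _ _ 0%N.
- by move=> i; exists 0%N.
- move=> i b c [n Ib] [m Ic]; exists (n + m)%N; rewrite iter_alphaB.
  by apply: IB; [rewrite addnC|]; apply: up.
- by move=> i b c [n Ic]; exists n; rewrite iter_alphaM; apply: IMl.
- by move=> i b [n Ib]; exists n; rewrite -iterSr; apply: Ia.
- move=> i b [n Ib]; exists n.+1; rewrite iter_alphaM; apply: IMl.
  by rewrite iterSr.
- by rewrite polyC_eq0.
- by move=> q i; exists 0%N; rewrite ore_mulC coefZ; apply: IMr.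
by rewrite iter_alpha1.
Qed.

Lemma simple_vpow_unit m : simple_ring R -> (1 <= m)%N -> is_unit (vpow D m).
Proof.
case: m => // n simR _.
pose P b := exists c, b = vpow D n.+1 * c.
have PM a b : P b -> P (a * b).
  case=> c ->; exists (aut_inv gamma a * c).
  by rewrite !mulrA vpow_normal aut_invK.
(* With no condition above degree n, y^(n+1) maps all of A[y; alpha] into the submodule. *)
pose K i b := (i <= n)%N -> P (iter (n - i) alpha b).
have [|||||||c] := @simple_submodule K simR _ _ _ _ _ 'X^(n.+1) _ _ n (leqnn n).
- move=> i _; exists 0; rewrite mulr0.
  by elim: (n - i)%N => //= k ->; rewrite raddf0.
- move=> i a b Ka Kb le_in; have [c ac] := Ka le_in; have [d bd] := Kb le_in.
  by exists (c - d); rewrite iter_alphaB ac bd mulrBr.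
- by move=> i a b Kb le_in; rewrite iter_alphaM; apply/PM/Kb.
- by move=> i b Kb lt_in; rewrite -iterSr -subSn // subSS; apply/Kb/ltnW.
- move=> i b Kb le_in; rewrite iter_alphaM.
  (* At i = n the hypothesis in degree n + 1 is empty, but v^(n+1) b lies in [P] by definition. *)
  move: le_in; rewrite leq_eqVlt => /predU1P[->|lt_in].
    by rewrite subnn /=; exists b.
  by apply: PM; have := Kb lt_in; rewrite -iterSr -subSn // subSS.
- by rewrite monic_neq0 // monicXn.
- move=> q i le_in; rewrite ore_mulXn.
  suff -> : (iter n.+1 (ore_shift sD) q)`_i = 0.
    exists 0; rewrite mulr0; by elim: (n - i)%N => //= k ->; rewrite raddf0.
  have {le_in} : (i < n.+1)%N := le_in; elim: n.+1 i => // k IHk i lt_ik /=.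
  rewrite coefD coefMX !coef_map /= addr0.
  by case: i lt_ik => // i lt_ik /=; rewrite IHk ?raddf0.
(* Here v^(n+1) c = 1; normality supplies the left inverse gamma(c), and the two inverses agree. *)
rewrite subnn /= => vc; have cv : gamma c * vpow D n.+1 = 1.
  by rewrite -vpow_normal.
exists c; split=> //; rewrite -[RHS]cv; congr (_ * _).
by rewrite -[LHS]mul1r -cv -mulrA -vc mulr1.
Qed.

End Necessity.

Theorem theorem3p10 (F : fieldType) (A : algType F) (D : ambiskew_datum A)
    (charF0 : [pchar F] =i pred0) :
  simple_ring (ambiskew D) <->
    [/\ alpha_simple (am_alpha D),
        singular D
      & forall m : nat, (1 <= m)%N -> is_unit (vpow D m)].
Proof.
split=> [simR|[simA singD unitv]].
  split; first exact: simple_alpha_simple.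
    by move/conformal_not_simple; apply.
  by move=> m; apply: simple_vpow_unit.
have [vi [viv vvi]] := unitv 1%N isT; rewrite vpow1 in viv vvi.
exact: (ambiskew_simple viv vvi).
Qed.
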